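(* Let $s \geq 3$ be a natural number and let $A$ be a finite subset of real numbers. Then $$J_{s,2}(A) \ll_{s} |A|^{2s-3+\eta_s},$$ where $\eta_3 = 1/2$, and $\eta_s = (1/4 - 1/7246)\cdot 2^{-s+4}$ for $s \geq 4$.
   Context: $J_{s,2}(A)$ denotes the number of solutions to the system $$\sum_{i=1}^{s} (x_i^2 - y_i^2) = \sum_{i=1}^{s} (x_i - y_i) = 0$$ with $x_i, y_i \in A$ for each $1 \leq i \leq s$. The notation $X \ll_{s} Y$ means $|X| \leq K|Y|$ for some constant $K>0$ depending only on $s$. *)

(* Defs.v *)
From HB Require Import structures.
From mathcomp Require Import all_boot all_order all_algebra.
From mathcomp Require Import finmap.
From mathcomp Require Import reals exp.

Set Implicit Arguments.
Unset Strict Implicit.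
Unset Printing Implicit Defensive.

Import Order.TTheory GRing.Theory Num.Theory.
Local Open Scope ring_scope.

(* [J2 s A] is J_{s,2}(A). The finite set [A] is coerced to the finite type of
   its elements, so [(x, y)] ranges over A^s x A^s. *)
Definition J2 (R : realType) (s : nat) (A : {fset R}) : nat :=
  #|[set xy : {ffun 'I_s -> A} * {ffun 'I_s -> A} |
      (\sum_(i < s) (val (xy.1 i) ^+ 2 - val (xy.2 i) ^+ 2) == 0) &&
      (\sum_(i < s) (val (xy.1 i) - val (xy.2 i)) == 0)]|.

(* Only meaningful for [3 <= s]; the power of 2 has an integer exponent. *)
Definition eta_exp (R : realType) (s : nat) : R :=
  if s == 3%N then 1 / 2
  else (1 / 4 - 1 / 7246) * 2 ^ (- s%:Z + 4).

(* Main.v *)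
Require Import Defs.
From HB Require Import structures.
From mathcomp Require Import all_boot all_order all_algebra.
From mathcomp Require Import finmap.
From mathcomp Require Import reals exp.
From mathcomp Require Import zify ring lra.

(** Write [P x = (x, x ^ 2)], [N = |A|], and let [E(S)] be the number of solutions
    of [s + P a = s' + P a'] with [s], [s'] in a finite plane set [S] and [a], [a'] in [A].
    A shear turns the translates [s + P R] into non-vertical lines, so the
    Szemeredi-Trotter theorem (via the crossing lemma) gives
    [E(S) << |S|^(3/2) N^(1/2) + |S| N].

    Base case.  Cut [A] into [M = N^(1/3)] blocks of consecutive elements.  A circle
    [x1 + x2 + x3 = n1], [x1^2 + x2^2 + x3^2 = n2] meets only [O(M)] of the cells that
    the blocks cut out in the [(x1, x2)]-plane, so by Cauchy-Schwarz [J_3(A)] is at most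
    [O(M)] times the number of solutions in which [x1], [y1] share a block and [x2], [y2]
    share a block.  The latter are governed by [E(S)], where [S] is the set of the
    [<< N^(5/3)] differences [P x - P y] inside blocks, and there are [<< N^3] of them.
    Hence [J_3(A) << N^(3 + 1/3)].

    Step.  Splitting the representation function of sums of [s] points of [P A] into
    dyadic levels and applying the bound on [E] to each level set gives, up to logarithms,
    [J_(s+1) << (J_s N^(2s+1))^(1/2)], which halves the excess of the exponent over
    [2s - 3].  From [1/3] at [s = 3] this reaches [2^(4-s) / 6 + o(1)] at [s], which is
    below [(1/4 - 1/7246) 2^(4-s)]. *)

Set Implicit Arguments.
Unset Strict Implicit.
Unset Printing Implicit Defensive.

Import Order.TTheory GRing.Theory Num.Theory.
Local Open Scope ring_scope.

(** * Straight-line plane graphs have linearly many edges *)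

(** Positivity at [p] persists just to the left of [p]. This turns a comparison of slopes at a
    common right end into a comparison of heights. *)
Lemma affine_pos_left (R : realFieldType) (a b p q : R) :
  q < p -> 0 < a * p + b -> exists2 x, q < x < p & 0 < a * x + b.
Proof.
move=> qp dp; have [dq|dq] := lerP 0 (a * q + b).
  exists ((p + q) / 2); first by apply/andP; split; lra.
  have -> : a * ((p + q) / 2) + b = (a * p + b + (a * q + b)) / 2 by field.
  lra.
set u := a * p + b in dp; set v := a * q + b in dq.
have uv : 0 < u - v by lra.
(* The midpoint between [p] and the zero of the function, where the value is [u / 2]. *)
exists (p - (p - q) * (u / (u - v)) / 2).
  have h : 0 < u / (u - v) by rewrite divr_gt0.
  have h1 : u / (u - v) < 1 by rewrite ltr_pdivrMr //; lra.
  by apply/andP; split; nra.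
have -> : a * (p - (p - q) * (u / (u - v)) / 2) + b = u / 2.
  rewrite /u /v; field.
  have -> : a * p + b - (a * q + b) = u - v by [].
  lra.
lra.
Qed.

Lemma affine_switch (R : realFieldType) (a b c d x1 x2 : R) :
  x1 != x2 -> a * x1 + b < c * x1 + d -> c * x2 + d < a * x2 + b ->
  exists x, [/\ Num.min x1 x2 < x, x < Num.max x1 x2 & a * x + b = c * x + d].
Proof.
move=> ne h1 h2.
set u := c * x1 + d - (a * x1 + b); set v := a * x2 + b - (c * x2 + d).
have u0 : 0 < u by rewrite /u; lra.
have v0 : 0 < v by rewrite /v; lra.
have uv : 0 < u + v by lra.
set w := u / (u + v).
have w0 : 0 < w by rewrite divr_gt0.
have w1 : w < 1 by rewrite ltr_pdivrMr //; lra.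
exists (x1 + (x2 - x1) * w); split.
- rewrite gt_min; move: ne; rewrite neq_lt => /orP[] h.
    by apply/orP; left; nra.
  by apply/orP; right; nra.
- rewrite lt_max; move: ne; rewrite neq_lt => /orP[] h.
    by apply/orP; right; nra.
  by apply/orP; left; nra.
- have uvE : w * (u + v) = u by rewrite /w divfK // gt_eqF.
  move: uvE; rewrite /u /v => uvE; lra.
Qed.

Section PlaneGraph.
Variables (R : realFieldType) (V E : finType) (px py : V -> R).
Variables (lft rgt : E -> V) (sl ic : E -> R).
Local Notation ht e x := (sl e * x + ic e).

Definition open_span (e : E) (x : R) := (px (lft e) < x) && (x < px (rgt e)).

Variables (Vs : {set V}) (Es : {set E}).
Hypothesis lftV : forall e, e \in Es -> lft e \in Vs.
Hypothesis rgtV : forall e, e \in Es -> rgt e \in Vs.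
Hypothesis ltr_edge : forall e, e \in Es -> px (lft e) < px (rgt e).
Hypothesis lft_on : forall e, e \in Es -> py (lft e) = ht e (px (lft e)).
Hypothesis rgt_on : forall e, e \in Es -> py (rgt e) = ht e (px (rgt e)).
Hypothesis pt_inj : forall u v, px u = px v -> py u = py v -> u = v.
Hypothesis no_inner_vertex : forall e w, e \in Es -> w \in Vs ->
  open_span e (px w) -> py w != ht e (px w).
Hypothesis no_crossing : forall e g x, e \in Es -> g \in Es -> e != g ->
  open_span e x -> open_span g x -> ht e x != ht g x.

Definition closed_span (e : E) (x : R) := (px (lft e) <= x) && (x <= px (rgt e)).

(** Edges that exchange order meet strictly between the two abscissas, hence in the interior of
    both, even when [x1] or [x2] is an end. *)
Lemma no_switch e g x1 x2 : e \in Es -> g \in Es ->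
  closed_span e x1 -> closed_span e x2 -> closed_span g x1 -> closed_span g x2 ->
  ht e x1 < ht g x1 -> ht g x2 < ht e x2 -> False.
Proof.
move=> eE gE; rewrite /closed_span => /andP[e1 e1'] /andP[e2 e2'] /andP[g1 g1'] /andP[g2 g2'] h1 h2.
have ne : x1 != x2 by apply/eqP => E12; move: h1 h2; rewrite E12; lra.
have eg : e != g by apply/eqP => E12; move: h1; rewrite E12; lra.
have [x [m1 m2 /eqP hx]] := affine_switch ne h1 h2.
have [lo hi] : (Num.max (px (lft e)) (px (lft g)) < x) /\ (x < Num.min (px (rgt e)) (px (rgt g))).
  split.
    by apply: le_lt_trans m1; rewrite le_min !ge_max e1 g1 e2 g2.
  by apply: lt_le_trans m2 _; rewrite ge_max !le_min e1' g1' e2' g2'.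
move: lo hi; rewrite gt_max lt_min => /andP[a1 a2] /andP[b1 b2].
by have := no_crossing eE gE eg (introT andP (conj a1 b1)) (introT andP (conj a2 b2)); rewrite hx.
Qed.

Lemma overlap_eq e g : e \in Es -> g \in Es -> sl e = sl g -> ic e = ic g ->
  px (lft e) < px (rgt g) -> px (lft g) < px (rgt e) -> e = g.
Proof.
move=> eE gE hs hi l1 l2; apply/eqP/negPn/negP => ne.
have le := ltr_edge eE; have lg := ltr_edge gE.
set a := Num.max (px (lft e)) (px (lft g)); set b := Num.min (px (rgt e)) (px (rgt g)).
have ab : a < b by rewrite /a /b gt_max !lt_min le l1 l2 lg.
have [ax xb] : a < (a + b) / 2 /\ (a + b) / 2 < b by split; lra.
have := @no_crossing e g ((a + b) / 2) eE gE ne.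
move: ax xb; rewrite /open_span {1}/a {2}/b gt_max lt_min => /andP[-> ->] /andP[-> ->].
by rewrite hs hi eqxx => /(_ isT isT).
Qed.

Lemma same_lft e g : e \in Es -> g \in Es -> lft e = lft g -> sl e = sl g -> e = g.
Proof.
move=> eE gE hl hs; apply: overlap_eq => //.
- by have := lft_on eE; have := lft_on gE; rewrite hl hs => ->; lra.
- by rewrite hl; apply: ltr_edge.
- by rewrite -hl; apply: ltr_edge.
Qed.

Lemma same_rgt e g : e \in Es -> g \in Es -> rgt e = rgt g -> sl e = sl g -> e = g.
Proof.
move=> eE gE hl hs; apply: overlap_eq => //.
- by have := rgt_on eE; have := rgt_on gE; rewrite hl hs => ->; lra.
- by rewrite -hl; apply: ltr_edge.
- by rewrite hl; apply: ltr_edge.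
Qed.

Definition next_edge e f := [/\ f \in Es, lft f = lft e, sl e < sl f &
  forall g, g \in Es -> lft g = lft e -> sl e < sl g -> sl f <= sl g].

(* [w] is a leftmost vertex in the closed wedge spanned by [e] and the next
   edge [f] leaving the same vertex. *)
Definition wedge e f w := [/\ e \in Es, next_edge e f, w \in Vs,
  [&& px (lft e) < px w, px w <= px (rgt e) & px w <= px (rgt f)] &
  forall z, z \in Vs -> px (lft e) < px z -> px z < px w ->
    ht e (px z) <= py z -> py z <= ht f (px z) -> False].

(** Follow [g] to the left from [x]. It cannot exchange order with [e] or [f], so it passes through
    the apex [lft e], or starts there with a slope strictly between those of [e] and [f], or starts
    at a vertex of the wedge to the left of [w]. Each case is excluded. *)
Lemma wedge_empty e f w g x : wedge e f w -> g \in Es ->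
  px (lft e) < x -> x <= px w -> px (lft g) < x -> x <= px (rgt g) ->
  ht e x < ht g x -> ht g x < ht f x -> False.
Proof.
case=> eE [fE fl sef nxt] wV /and3P[uw we wf] mn gE ux xw gx xg h1 h2.
have uy := lft_on eE; have uyf := lft_on fE; rewrite fl in uyf.
have eR : x <= px (rgt e) by apply: le_trans we.
have fR : x <= px (rgt f) by apply: le_trans wf.
have ex : closed_span e x by rewrite /closed_span (ltW ux).
have fx : closed_span f x by rewrite /closed_span fl (ltW ux).
have gxo : closed_span g x by rewrite /closed_span (ltW gx).
have lg := lft_on gE.
have [lgu|ulg|lgu] := ltgtP (px (lft g)) (px (lft e)).
- have gu : closed_span g (px (lft e)) by rewrite /closed_span (ltW lgu) (le_trans (ltW ux)).
  have eu : closed_span e (px (lft e)) by rewrite /closed_span lexx (ltW (ltr_edge eE)).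
  have fu : closed_span f (px (lft e)) by rewrite /closed_span -fl lexx (ltW (ltr_edge fE)).
  have [h|h|h] := ltgtP (ht g (px (lft e))) (py (lft e)).
  + by apply: (no_switch gE eE gu gxo eu ex) => //; rewrite -uy.
  + by apply: (no_switch fE gE fu fx gu gxo) => //; rewrite -uyf.
  + have : open_span g (px (lft e)) by rewrite /open_span lgu (lt_le_trans ux).
    by move/(no_inner_vertex gE (lftV eE)); rewrite h eqxx.
- have gl : closed_span g (px (lft g)) by rewrite /closed_span lexx (ltW (ltr_edge gE)).
  have el : closed_span e (px (lft g)) by rewrite /closed_span (ltW ulg) (le_trans (ltW gx)).
  have fll : closed_span f (px (lft g)) by rewrite /closed_span fl (ltW ulg) (le_trans (ltW gx)).
  have [h|h] := ltP (py (lft g)) (ht e (px (lft g))).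
    by apply: (no_switch gE eE gl gxo el ex) => //; rewrite -lg.
  have [h'|h'] := ltP (ht f (px (lft g))) (py (lft g)).
    by apply: (no_switch fE gE fll fx gl gxo) => //; rewrite -lg.
  by apply: (mn (lft g)) => //; [exact: lftV | exact: lt_le_trans xw].
- have gu : closed_span g (px (lft e)) by rewrite /closed_span lgu lexx (le_trans (ltW ux)).
  have eu : closed_span e (px (lft e)) by rewrite /closed_span lexx (ltW (ltr_edge eE)).
  have fu : closed_span f (px (lft e)) by rewrite /closed_span -fl lexx (ltW (ltr_edge fE)).
  rewrite lgu in lg.
  have [h|h|h] := ltgtP (py (lft g)) (py (lft e)).
  + by apply: (no_switch gE eE gu gxo eu ex) => //; rewrite -uy -lg.
  + by apply: (no_switch fE gE fu fx gu gxo) => //; rewrite -uyf -lg.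
  + have gel : lft g = lft e by apply: pt_inj.
    have sg : sl e < sl g by nra.
    have := nxt _ gE gel sg.
    by nra.
Qed.

(** Just left of [rgt e] the edge [e'] would run strictly inside the wedge. Hence [e] has the least
    slope among the edges ending there and can be recovered from that vertex. *)
Lemma wedge_rgt_lower e f e' : wedge e f (rgt e) -> e' \in Es ->
  rgt e' = rgt e -> sl e' < sl e -> False.
Proof.
move=> W eE' re ss; have [eE [fE fl sef nxt] wV /and3P[uw _ wf] mn] := W.
have h0 : 0 < (sl f - sl e') * px (rgt e) + (ic f - ic e').
  have := rgt_on eE; have := rgt_on eE'; rewrite re => ->.
  have := lft_on eE; have := lft_on fE; rewrite fl => ->.
  by nra.
have q : Num.max (px (lft e)) (px (lft e')) < px (rgt e).
  by rewrite gt_max uw -re ltr_edge.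
have [x /andP[qx xp] hx] := affine_pos_left q h0.
move: qx; rewrite gt_max => /andP[q1 q2].
apply: (wedge_empty W eE' q1 (ltW xp) q2); first by rewrite re ltW.
  have := rgt_on eE; have := rgt_on eE'; rewrite re => ->.
  by nra.
by lra.
Qed.

Lemma wedge_rgt_upper e f f' : wedge e f (rgt f) -> f' \in Es ->
  rgt f' = rgt f -> sl f < sl f' -> False.
Proof.
move=> W fE' rf ss; have [eE [fE fl sef nxt] wV /and3P[uw we _] mn] := W.
have h0 : 0 < (sl f' - sl e) * px (rgt f) + (ic f' - ic e).
  have := rgt_on fE; have := rgt_on fE'; rewrite rf => ->.
  have := lft_on eE; have := lft_on fE; rewrite fl => ->.
  by nra.
have q : Num.max (px (lft e)) (px (lft f')) < px (rgt f).
  by rewrite gt_max uw -rf ltr_edge.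
have [x /andP[qx xp] hx] := affine_pos_left q h0.
move: qx; rewrite gt_max => /andP[q1 q2].
apply: (wedge_empty W fE' q1 (ltW xp) q2); first by rewrite rf ltW.
  by lra.
have := rgt_on fE; have := rgt_on fE'; rewrite rf => ->.
by nra.
Qed.

Lemma next_edge_inj e e' f : e \in Es -> e' \in Es ->
  next_edge e f -> next_edge e' f -> e = e'.
Proof.
move=> eE eE' [fE fl sef nx] [_ fl' sef' nx'].
have ll : lft e = lft e' by rewrite -fl -fl'.
apply: same_lft => //.
have [h|h|//] := ltgtP (sl e) (sl e').
- by have := nx _ eE' (esym ll) h; lra.
- by have := nx' _ eE ll h; lra.
Qed.

(** If one edge were higher than the other at [px w], it would run inside the other's wedge;
    distinct edges of equal height there would cross. *)
Lemma wedge_strict_inj e f e' f' w : wedge e f w -> wedge e' f' w ->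
  px w < px (rgt e) -> px w < px (rgt e') ->
  ht e (px w) < py w -> py w < ht f (px w) ->
  ht e' (px w) < py w -> py w < ht f' (px w) -> e = e'.
Proof.
move=> W W' we we' h1 h2 h3 h4.
have [eE _ _ /and3P[uw _ _] _] := W; have [eE' _ _ /and3P[uw' _ _] _] := W'.
have [h|h|h] := ltgtP (ht e (px w)) (ht e' (px w)).
- by case: (wedge_empty W eE' uw (lexx _) uw' (ltW we') h); lra.
- by case: (wedge_empty W' eE uw' (lexx _) uw (ltW we) h); lra.
- apply/eqP/negPn/negP => ne.
  have := @no_crossing e e' (px w) eE eE' ne.
  by rewrite /open_span uw we uw' we' h eqxx => /(_ isT isT).
Qed.

(* The vertex [w] closing the wedge above [e] is the right end of [e], the right
   end of the next edge, or lies inside the wedge; each vertex is charged at most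
   once in each of these three ways. *)
Definition charged e (kw : 'I_3 * V) := [/\ kw.2 \in Vs & exists2 f, wedge e f kw.2 &
  match nat_of_ord kw.1 with
  | 0%N => kw.2 = rgt e
  | 1%N => kw.2 = rgt f
  | _ => [/\ px kw.2 < px (rgt e), ht e (px kw.2) < py kw.2 & py kw.2 < ht f (px kw.2)]
  end].

Lemma charged_inj e e' kw : charged e kw -> charged e' kw -> e = e'.
Proof.
case: kw => [[k kP] w] [/= _ [f W +]] [/= _ [f' W' +]].
have [eE fn _ _ _] := W; have [eE' fn' _ _ _] := W'.
case: k kP => [|[|k]] _ /=.
- move=> we we'; rewrite we in W; rewrite we' in W'.
  have r : rgt e' = rgt e by rewrite -we -we'.
  apply: same_rgt => //; have [h|h|//] := ltgtP (sl e) (sl e').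
  + by case: (wedge_rgt_lower W' eE).
  + by case: (wedge_rgt_lower W eE').
- move=> wf wf'; rewrite wf in W; rewrite wf' in W'.
  have r : rgt f' = rgt f by rewrite -wf -wf'.
  have [fE _ _ _] := fn; have [fE' _ _ _] := fn'.
  have ff : f = f'.
    apply: same_rgt => //; have [h|h|//] := ltgtP (sl f) (sl f').
    + by case: (wedge_rgt_upper W fE').
    + by case: (wedge_rgt_upper W' fE).
  by apply: next_edge_inj fn _ => //; rewrite ff.
- by move=> [a1 a2 a3] [b1 b2 b3]; apply: (wedge_strict_inj W W').
Qed.

Definition nontop := [set e in Es | [exists f in Es, (lft f == lft e) && (sl e < sl f)]].

Lemma nontop_charged e : e \in nontop -> exists kw, charged e kw.
Proof.
rewrite inE => /andP[eE /existsP[f0 /andP[f0E /andP[l0 s0]]]].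
have [f [fE fl sf] fmin] : exists2 f, [/\ f \in Es, lft f = lft e & sl e < sl f] &
    forall g, g \in Es -> lft g = lft e -> sl e < sl g -> sl f <= sl g.
  pose Q f := [&& f \in Es, lft f == lft e & sl e < sl f].
  have Q0 : Q f0 by rewrite /Q f0E l0 s0.
  case: (arg_minP sl Q0) => f /and3P[fE /eqP fl sf] mn.
  by exists f => // g gE gl sg; apply: mn; rewrite /Q gE gl eqxx.
have nx : next_edge e f by [].
(* The vertices of the closed wedge. The nearer of [rgt e] and [rgt f] is among them, so a leftmost
   one exists. *)
pose W z := [&& z \in Vs, px (lft e) < px z, px z <= px (rgt e), px z <= px (rgt f),
   ht e (px z) <= py z & py z <= ht f (px z)].
have uye := lft_on eE; have uyf := lft_on fE; rewrite fl in uyf.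
have le := ltr_edge eE; have lf := ltr_edge fE; rewrite fl in lf.
have We : px (rgt e) <= px (rgt f) -> W (rgt e).
  move=> h; rewrite /W rgtV // le lexx h (rgt_on eE) lexx /=; nra.
have Wf : px (rgt f) <= px (rgt e) -> W (rgt f).
  move=> h; rewrite /W rgtV // lf lexx h (rgt_on fE) lexx /= andbT; nra.
have [z0 Wz0] : exists z0, W z0.
  by have [h|/ltW h] := leP (px (rgt e)) (px (rgt f)); [exists (rgt e)| exists (rgt f)]; auto.
case: (arg_minP px Wz0) => w /andP[wV /and5P[w1 w2 w3 w4 w5]] mn.
(* Being leftmost depends only on the abscissa, so [w] may be replaced by [rgt e] or [rgt f] when
   these lie on the same vertical line. *)
have wedgeP z : z \in Vs -> px (lft e) < px z -> px z = px w -> wedge e f z.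
  move=> zV uz zw; split=> //; first by rewrite uz zw w2.
  move=> y yV uy yz h1 h2.
  have : W y by rewrite /W yV uy h1 h2 !(le_trans (ltW yz)) // zw.
  by move/mn; rewrite -zw; lra.
have [h|h] := leP (px (rgt e)) (px w).
  have hw : px (rgt e) = px w by apply/eqP; rewrite eq_le h w2.
  exists (@Ordinal 3 0 isT, rgt e); split; first exact: rgtV.
  by exists f => //=; apply: wedgeP => //; exact: rgtV.
have [h'|h'] := leP (px (rgt f)) (px w).
  have hw : px (rgt f) = px w by apply/eqP; rewrite eq_le h' w3.
  exists (@Ordinal 3 1 isT, rgt f); split; first exact: rgtV.
  by exists f => //=; apply: wedgeP => //; exact: rgtV.
exists (@Ordinal 3 2 isT, w); split => //; exists f; first exact: wedgeP.
have n1 := @no_inner_vertex e w eE wV; have n2 := @no_inner_vertex f w fE wV.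
move: n1 n2; rewrite /open_span w1 h fl w1 h' => /(_ isT) n1 /(_ isT) n2.
by split => //=; rewrite lt_neqAle ?w4 ?w5 ?n2 ?andbT // eq_sym.
Qed.

(** An edge of largest slope at its left end is determined by that end, which accounts for [#|Vs|]
    edges. All others are charged injectively to three copies of [Vs]. *)
Lemma plane_graph_edges : (#|Es| <= 4 * #|Vs|)%N.
Proof.
have top : (#|Es :\: nontop| <= #|Vs|)%N.
  have inj : {in Es :\: nontop &, injective lft}.
    move=> e g; rewrite !inE => /andP[/nandP[] + eE] /andP[/nandP[] + gE]; rewrite ?eE ?gE //.
    rewrite !negb_exists => /forallP/(_ g) e1 /forallP/(_ e) g1 hl.
    apply: same_lft => //; move: e1 g1; rewrite eE gE hl eqxx /=.
    by case: ltgtP.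
  rewrite -(card_in_imset inj); apply/subset_leq_card/subsetP => v /imsetP[e].
  by rewrite !inE => /andP[_ /lftV] + ->.
have rest : (#|nontop| <= 3 * #|Vs|)%N.
  have [|c cP] := @fin_all_exists E (fun _ => ('I_3 * V)%type) (fun e kw => e \in nontop -> charged e kw).
    move=> e; case: (boolP (e \in nontop)) => [/nontop_charged[kw]|_]; first by exists kw.
    by exists (ord0, lft e).
  have inj : {in nontop &, injective c}.
    by move=> e g /cP ce /cP cg h; apply: charged_inj ce _; rewrite h.
  have -> : (3 * #|Vs| = #|setX [set: 'I_3] Vs|)%N by rewrite cardsX cardsT card_ord.
  rewrite -(card_in_imset inj).
  apply/subset_leq_card/subsetP => kw /imsetP[e /cP[eV _] ->].
  by rewrite !inE /= eV.
rewrite -(cardsID nontop Es) mulSn addnC; apply: leq_add => //.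
by apply: leq_trans rest; apply/subset_leq_card/subsetIr.
Qed.

End PlaneGraph.

(** * The crossing lemma *)

(** Denominator-free form of the fact that the distinct vertices in [s] all receive colour zero with
    probability [(t + 1)^(- size s)]. *)
Lemma card_ffun_zero_on (V : finType) (t : nat) (s : seq V) : uniq s ->
  (#|[set c : {ffun V -> 'I_t.+1} | all (fun v => c v == ord0) s]| * t.+1 ^ size s
     = t.+1 ^ #|V|)%N.
Proof.
move=> us; pose F v : pred 'I_t.+1 := if v \in s then pred1 ord0 else predT.
have -> : #|[set c : {ffun V -> 'I_t.+1} | all (fun v => c v == ord0) s]| = #|family F|.
  apply: eq_card => c; rewrite inE; apply/allP/familyP => h v.
    by rewrite /F; case: ifP => // vs; apply: h.
  by move=> vs; have := h v; rewrite /F vs.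
rewrite card_family /image_mem foldrE big_map big_enum /=.
rewrite (bigID (mem s)) /= big1 => [|v vs]; last by rewrite /F vs card1.
rewrite mul1n (eq_bigr (fun=> t.+1)) => [|v vs]; last by rewrite /F (negbTE vs) -[RHS]card_ord; apply: eq_card.
rewrite prod_nat_const -expnD; congr (_ ^ _)%N.
by rewrite addnC -(card_uniqP us) -(cardC (mem s)).
Qed.

Section CrossingLemma.
Variables (V E : finType) (lft rgt : E -> V) (Es : {set E}) (X : {set E * E}).
Hypothesis loopless : forall e, e \in Es -> lft e != rgt e.
Hypothesis disjoint_ends : forall e g, (e, g) \in X ->
  uniq [:: lft e; rgt e; lft g; rgt g].
Hypothesis planar_bound : forall (Vs : {set V}) (Fs : {set E}), Fs \subset Es ->
  (forall e, e \in Fs -> (lft e \in Vs) && (rgt e \in Vs)) ->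
  (forall e g, e \in Fs -> g \in Fs -> e != g -> (e, g) \notin X) ->
  (#|Fs| <= 4 * #|Vs|)%N.

(* Keep each vertex with probability [1 / t.+1], delete one edge from every
   surviving crossing, and average the planar bound. *)
Lemma crossing_lemma t : (#|Es| * t.+1 ^ 2 <= 4 * #|V| * t.+1 ^ 3 + #|X|)%N.
Proof.
pose zero (s : seq V) (c : {ffun V -> 'I_t.+1}) := all (fun v => c v == ord0) s.
pose T := (t.+1 ^ #|V|)%N.
(* Linearity of expectation over uniform colourings [c], cleared of denominators; colour [ord0]
   means that the vertex is kept. *)
have cnt (I : finType) (A : {set I}) (f : I -> seq V) k :
    (forall i, i \in A -> uniq (f i) /\ size (f i) = k) ->
    ((\sum_(c : {ffun V -> 'I_t.+1}) \sum_(i in A) zero (f i) c) * t.+1 ^ k = #|A| * T)%N.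
  move=> fP; rewrite exchange_big /= big_distrl /= -sum_nat_const; apply: eq_bigr => i /fP[u sz].
  rewrite -sz /T -(card_ffun_zero_on t u) -sum1dep_card [in RHS]big_mkcond /=.
  congr (_ * _)%N; by apply: eq_bigr => c _; rewrite /zero; case: all.
have main c : (\sum_(e in Es) zero [:: lft e; rgt e] c <=
    4 * (\sum_(v in [set: V]) zero [:: v] c) +
    \sum_(p in X) zero [:: lft p.1; rgt p.1; lft p.2; rgt p.2] c)%N.
  pose Vs := [set v | c v == ord0].
  pose Ec := [set e in Es | zero [:: lft e; rgt e] c].
  pose Xc := [set p in X | zero [:: lft p.1; rgt p.1; lft p.2; rgt p.2] c].
  have sumc (I : finType) (A : {set I}) (P : pred I) :
      (\sum_(i in A) P i)%N = #|[set i in A | P i]|.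
    rewrite -sum1dep_card big_mkcondr /=; apply: eq_bigr => i _; by case: (P i).
  rewrite !sumc -/Ec -/Xc.
  have -> : [set v in [set: V] | zero [:: v] c] = Vs.
    by apply/setP => v; rewrite !inE /zero /= andbT.
  pose Fs := Ec :\: [set p.1 | p in Xc].
  have : (#|Fs| <= 4 * #|Vs|)%N.
    apply: planar_bound.
    - by apply/subsetP => e; rewrite !inE => /and3P[].
    - by move=> e; rewrite !inE /zero /= => /and3P[_ _]; rewrite andbT.
    - move=> e g /setDP[]; rewrite inE => /andP[_ ze] nX /setDP[].
      rewrite inE => /andP[_ zg] _ _; apply/negP => egX; case/imsetP: nX.
      exists (e, g) => //; rewrite inE egX /=; move: ze zg; rewrite /zero /=.
      by move=> /and3P[-> -> _] /and3P[-> -> _].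
  have h1 := cardsID [set p.1 | p in Xc] Ec.
  have h2 : (#|Ec :&: [set p.1 | p in Xc]| <= #|Xc|)%N.
    by apply: leq_trans (subset_leq_card (subsetIr _ _)) (leq_imset_card _ _).
  rewrite -/Fs in h1; lia.
have {main} main := leq_sum (P := xpredT) (index_enum _) (fun c _ => main c).
rewrite big_split -big_distrr /= in main.
have cE : ((\sum_(c : {ffun V -> 'I_t.+1}) \sum_(e in Es) zero [:: lft e; rgt e] c) * t.+1 ^ 2 = #|Es| * T)%N.
  apply: cnt => e eE; by rewrite /= inE loopless.
have cV : ((\sum_(c : {ffun V -> 'I_t.+1}) \sum_(v in [set: V]) zero [:: v] c) * t.+1 ^ 1 = #|[set: V]| * T)%N
  by apply: cnt.
have cX : ((\sum_(c : {ffun V -> 'I_t.+1})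
    \sum_(p in X) zero [:: lft p.1; rgt p.1; lft p.2; rgt p.2] c) * t.+1 ^ 4 = #|X| * T)%N.
  apply: cnt => -[e g].
  by move=> /disjoint_ends.
rewrite cardsT in cV.
have T0 : (0 < T)%N by rewrite expn_gt0.
rewrite -(leq_pmul2r T0) mulnDl -cX.
have -> : (#|Es| * t.+1 ^ 2 * T = t.+1 ^ 2 * (#|Es| * T))%N by ring.
have -> : (4 * #|V| * t.+1 ^ 3 * T = 4 * t.+1 ^ 3 * (#|V| * T))%N by ring.
rewrite -cE -cV.
move: main; rewrite -(@leq_pmul2r (t.+1 ^ 4)) ?expn_gt0 // => main.
apply: leq_trans (leq_trans main _); apply/eq_leq; ring.
Qed.
End CrossingLemma.

(** * Points rich in lines *)

Section RichPoints.
Variables (R : realFieldType) (L V : finType) (sl ic : L -> R) (px py : V -> R).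
Hypothesis line_inj : forall l m, sl l = sl m -> ic l = ic m -> l = m.
Hypothesis pt_inj : forall u v, px u = px v -> py u = py v -> u = v.

Definition on_line (l : L) (v : V) := py v == sl l * px v + ic l.

Definition later (e : L * V) w := on_line e.1 w && (px e.2 < px w).

(** A pair [(l, v)] encodes the segment of [l] from [v] to the next point on it. On [arcs] the
    default [e.2] is not returned. *)
Definition succ_pt (e : L * V) : V :=
  odflt e.2 [pick w | later e w && [forall z, later e z ==> (px w <= px z)]].

Definition arcs : {set L * V} := [set e | on_line e.1 e.2 && [exists w, later e w]].

Lemma succ_ptP e : e \in arcs ->
  later e (succ_pt e) /\ forall z, later e z -> px (succ_pt e) <= px z.
Proof.
rewrite inE => /andP[_ /existsP[w0 w0P]]; rewrite /succ_pt.
case: pickP => [w /andP[wP /forallP wmin]|none]; first by split=> // z; apply/implyP.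
case: (arg_minP px w0P) => w wP wmin.
have := none w; rewrite wP /= => /forallP[] z.
by apply/implyP/wmin.
Qed.

Lemma on_same_line l v w : on_line l v -> on_line l w -> px v = px w -> v = w.
Proof. by move=> /eqP h1 /eqP h2 h; apply: pt_inj => //; rewrite h1 h2 h. Qed.

(** On each line only the last point fails to start an arc. *)
Lemma incidences_le_arcs : (#|[set e | on_line e.1 e.2]| <= #|arcs| + #|L|)%N.
Proof.
rewrite -(cardsID arcs [set e | on_line e.1 e.2]); apply: leq_add; first exact: subset_leq_card (subsetIr _ _).
have inj : {in [set e : L * V | on_line e.1 e.2] :\: arcs &, injective fst}.
  move=> [l v] [m w]; rewrite !inE /= => /andP[+ iv] /andP[+ iw] lm; rewrite -lm in iw *.
  rewrite iv iw /= !negb_exists => /forallP/(_ w) + /forallP/(_ v).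
  rewrite /later /= iv iw /= => h1 h2; congr pair.
  by apply: (on_same_line iv iw); move: h1 h2; case: ltgtP.
by rewrite -(card_in_imset inj); apply: max_card.
Qed.

Definition line_meet (e g : L * V) := (ic g.1 - ic e.1) / (sl e.1 - sl g.1).

Local Notation inn e x := (open_span px snd succ_pt e x).

Definition arc_crossings : {set (L * V) * (L * V)} :=
  [set p | [&& p.1 \in arcs, p.2 \in arcs, sl p.1.1 != sl p.2.1,
     inn p.1 (line_meet p.1 p.2) & inn p.2 (line_meet p.1 p.2)]].

Lemma line_meetE (e g : L * V) x : sl e.1 != sl g.1 ->
  sl e.1 * x + ic e.1 = sl g.1 * x + ic g.1 -> x = line_meet e g.
Proof.
move=> ne h; rewrite /line_meet.
have d0 : sl e.1 - sl g.1 != 0 by rewrite subr_eq0.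
by apply: (mulIf d0); rewrite divfK //; lra.
Qed.

(** The ends of an arc are consecutive on its line, so no other arc of that line starts inside
    it. *)
Lemma arc_inner_eq (e g : L * V) x : e \in arcs -> g \in arcs -> e.1 = g.1 ->
  inn e x -> inn g x -> e = g.
Proof.
move=> eA gA l1 /andP[a1 a2] /andP[b1 b2].
have [/andP[_ _] em] := succ_ptP eA; have [/andP[_ _] gm] := succ_ptP gA.
have ie : on_line e.1 e.2 by move: eA; rewrite inE => /andP[].
have ig : on_line g.1 g.2 by move: gA; rewrite inE => /andP[].
have [h|h|h] := ltgtP (px e.2) (px g.2).
- have /em : later e g.2 by rewrite /later l1 ig h.
  by rewrite leNgt (lt_trans b1 a2).
- have /gm : later g e.2 by rewrite /later -l1 ie h.
  by rewrite leNgt (lt_trans a1 b2).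
- have h2 : e.2 = g.2 by apply: (on_same_line ie _ h); rewrite l1.
  by case: e g l1 h2 {eA gA a1 a2 b1 b2 em gm ie ig h} => [? ?] [? ?] /= -> ->.
Qed.

(** Two lines of different slope meet over one abscissa, interior to at most one arc of each, so the
    two lines determine the crossing. *)
Lemma card_arc_crossings : (#|arc_crossings| <= #|L| ^ 2)%N.
Proof.
have inj : {in arc_crossings &, injective (fun p : (L * V) * (L * V) => (p.1.1, p.2.1))}.
  move=> [e g] [e' g']; rewrite inE => /and5P[/= eA gA ne i1 i2].
  rewrite inE => /and5P[/= eA' gA' ne' i1' i2'].
  case=> l1 l2.
  have mm : line_meet e g = line_meet e' g' by rewrite /line_meet l1 l2.
  rewrite -mm in i1' i2'.
  by rewrite (arc_inner_eq eA eA' l1 i1 i1') (arc_inner_eq gA gA' l2 i2 i2').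
by rewrite -(card_in_imset inj) expnS expn1 -card_prod; apply: max_card.
Qed.

Lemma arcs_bound t : (#|arcs| * t.+1 ^ 2 <= 4 * #|V| * t.+1 ^ 3 + #|L| ^ 2)%N.
Proof.
apply: leq_trans (leq_add (leqnn _) card_arc_crossings).
have ll e : e \in arcs -> px e.2 < px (succ_pt e) by move/succ_ptP => [/andP[]].
have lon (e : L * V) : e \in arcs -> py e.2 = sl e.1 * px e.2 + ic e.1.
  by rewrite inE => /andP[/eqP].
have ron (e : L * V) : e \in arcs -> py (succ_pt e) = sl e.1 * px (succ_pt e) + ic e.1.
  by move/succ_ptP => [/andP[/eqP]].
have loop (e : L * V) : e \in arcs -> e.2 != succ_pt e.
  by move=> /ll; apply: contraTN => /eqP <-; rewrite ltxx.
apply: (@crossing_lemma _ _ snd succ_pt).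
- exact: loop.
(* A common end of the two arcs would be the meeting point of their lines, which is interior to both
   arcs. *)
- move=> e g; rewrite inE => /and5P[/= eA gA ne /andP[e1 e2] /andP[g1 g2]].
  have le := lon _ eA; have lg := lon _ gA; have re := ron _ eA; have rg := ron _ gA.
  rewrite /= !inE !negb_or -!andbA !andbT.
  have d0 u v : sl e.1 * px u + ic e.1 = py u -> sl g.1 * px v + ic g.1 = py v ->
      px u != line_meet e g -> u != v.
    move=> hu hv hx; apply: contraNN hx => /eqP uv; apply/eqP/line_meetE => //.
    by rewrite hu uv hv.
  by rewrite !loop // !d0 // ?(lt_eqF e1) ?(gt_eqF e2).
move=> Vs Fs sF FV noX.
have sA e : e \in Fs -> e \in arcs by move/(subsetP sF).
apply: (@plane_graph_edges R V _ px py snd succ_pt (fun e => sl e.1) (fun e => ic e.1)).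
- by move=> e /FV /andP[].
- by move=> e /FV /andP[].
- by move=> e /sA; apply: ll.
- by move=> e /sA; apply: lon.
- by move=> e /sA; apply: ron.
- exact: pt_inj.
- move=> e w /sA eA _ /andP[h1 h2]; apply/negP => h.
  have /(proj2 (succ_ptP eA)) : later e w by rewrite /later /on_line h h1.
  by rewrite leNgt h2.
- move=> e g x eF gF ne i1 i2; apply/negP => /eqP h.
  have eA := sA _ eF; have gA := sA _ gF.
  (* With equal slopes both arcs lie on one line; otherwise [x] is [line_meet e g] and the pair
     belongs to [arc_crossings]. *)
  have [s|s] := eqVneq (sl e.1) (sl g.1).
    have l1 : e.1 = g.1 by apply: line_inj => //; move: h; rewrite s; lra.
    by case/eqP: ne; apply: arc_inner_eq i1 i2.
  have := noX _ _ eF gF ne; rewrite inE /= eA gA s /=.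
  by rewrite -(line_meetE s h) i1 i2.
Qed.

(** Richness gives at least [8 * t.+1 * #|V|] incidences, and half of them cancels the vertex term
    of [arcs_bound]. *)
Lemma rich_points t : (forall v, 8 * t.+1 <= #|[set l | on_line l v]|)%N ->
  (4 * #|V| * t.+1 ^ 3 <= #|L| ^ 2 + #|L| * t.+1 ^ 2)%N.
Proof.
move=> rich.
have inc : (#|V| * (8 * t.+1) <= #|[set e : L * V | on_line e.1 e.2]|)%N.
  rewrite -sum_nat_const -sum1dep_card.
  rewrite (eq_bigl (fun e : L * V => xpredT e.1 && on_line e.1 e.2)) //.
  rewrite -(pair_big_dep xpredT on_line (fun _ _ => 1%N)) /= (exchange_big_dep xpredT) //=.
  by apply: leq_sum => v _; apply: leq_trans (rich v) _; rewrite -sum1dep_card.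
have h1 := incidences_le_arcs; have h2 := arcs_bound t.
have h3 := leq_trans inc h1.
have h4 : (#|V| * (8 * t.+1) * t.+1 ^ 2 <= (#|arcs| + #|L|) * t.+1 ^ 2)%N.
  by rewrite leq_pmul2r // expn_gt0.
move: h4; rewrite mulnDl.
have -> : (#|V| * (8 * t.+1) * t.+1 ^ 2 = 4 * #|V| * t.+1 ^ 3 + 4 * #|V| * t.+1 ^ 3)%N by ring.
lia.
Qed.

End RichPoints.

(** * Energy of a plane set against the parabola *)

Definition collisions (U : finType) (Y : eqType) (psi : U -> Y) : nat :=
  #|[set p : U * U | psi p.1 == psi p.2]|.

(** Sums over fibres need a finite codomain; the set of values of [psi] serves. *)
Lemma finite_image (U : finType) (Y : choiceType) (psi : U -> Y) :
  exists (Z : finType) (psi' : U -> Z) (j : Z -> Y),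
    injective j /\ forall u, psi u = j (psi' u).
Proof.
exists (seq_sub (codom psi)), (fun u => SeqSub (codom_f psi u)), (@ssval _ _).
by split=> // x y; apply: val_inj.
Qed.

Lemma collisions_inj (U : finType) (Z Y : eqType) (psi' : U -> Z) (j : Z -> Y) (psi : U -> Y) :
  injective j -> (forall u, psi u = j (psi' u)) -> collisions psi = collisions psi'.
Proof. by move=> jI h; apply: eq_card => p; rewrite !inE !h inj_eq. Qed.

Lemma collisions_fibers (U Z : finType) (psi : U -> Z) :
  collisions psi = (\sum_z #|[set u | psi u == z]| ^ 2)%N.
Proof.
rewrite /collisions -sum1dep_card (partition_big (fun p => psi p.1) predT) //=.
apply: eq_bigr => z _; rewrite sum1dep_card expnS expn1 -cardsX; apply: eq_card => p.
by rewrite !inE; apply/andP/andP => -[/eqP h /eqP h']; split; apply/eqP; congruence.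
Qed.

Lemma sum_fibers (U Z : finType) (psi : U -> Z) :
  (\sum_z #|[set u | psi u == z]| = #|U|)%N.
Proof.
rewrite -[RHS]sum1_card (partition_big psi predT) //=.
by apply: eq_bigr => z _; rewrite sum1dep_card.
Qed.

Definition parab (R : pzRingType) (x : R) : R * R := (x, x ^+ 2).

Section ParabolaEnergy.
Variables (R : realFieldType) (S I : finType) (sg : S -> R * R) (a : I -> R).
Hypotheses (sg_inj : injective sg) (a_inj : injective a).

Definition translate (u : S * I) : R * R := sg u.1 + parab (a u.2).

Section Fibers.
Variables (Z : finType) (psi : S * I -> Z) (j : Z -> R * R).
Hypotheses (j_inj : injective j) (psiE : forall u, translate u = j (psi u)).

Let r z := #|[set u | psi u == z]|.

Lemma fiber_le_index z : (r z <= #|I|)%N.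
Proof.
have inj : {in [set u | psi u == z] &, injective snd}.
  move=> [s i] [s' i']; rewrite !inE => /eqP h /eqP h' /= ii; rewrite -ii in h' *.
  have := psiE (s, i); rewrite h -h' -psiE /translate /= => /addIr /sg_inj ->.
  by [].
by rewrite /r -(card_in_imset inj); apply: max_card.
Qed.

(* After the shear [(x, y) |-> (x, y - x ^ 2)] the translates of the parabola
   become lines of slope [-2 s.1]. *)
Lemma rich_fibers t :
  (4 * #|[set z | 8 * t.+1 <= r z]| * t.+1 ^ 3 <= #|S| ^ 2 + #|S| * t.+1 ^ 2)%N.
Proof.
set V := [set z | _]%N.
have := @rich_points R S {z | z \in V} (fun s => - 2 * (sg s).1)
  (fun s => (sg s).1 ^+ 2 + (sg s).2) (fun z => (j (val z)).1)
  (fun z => (j (val z)).2 - (j (val z)).1 ^+ 2).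
have -> : #|{: {z | z \in V}}| = #|V| by rewrite card_sig; apply: eq_card.
apply.
- move=> s s' h1 h2; apply: sg_inj; have h : (sg s).1 = (sg s').1 by lra.
  by rewrite [LHS]surjective_pairing [RHS]surjective_pairing h; congr pair; rewrite h in h2; lra.
- move=> u v h1 h2; apply/val_inj/j_inj.
  by rewrite [LHS]surjective_pairing [RHS]surjective_pairing h1; congr pair; rewrite h1 in h2; lra.
- move=> [z zV] /=; have : (8 * t.+1 <= r z)%N by have := zV; rewrite inE.
  move/leq_trans; apply.
  have inj : {in [set u | psi u == z] &, injective fst}.
    move=> [s i] [s' i']; rewrite !inE => /eqP h /eqP h' /= ii; rewrite -ii in h' *.
    have := psiE (s, i); rewrite h -h' -psiE /translate /= => /addrI /(congr1 fst) /= /a_inj ->.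
    by [].
  rewrite /r -(card_in_imset inj); apply/subset_leq_card/subsetP => s /imsetP[[s' i]].
  rewrite !inE => /eqP h /= ->; rewrite /on_line /= -h -psiE /translate /=; apply/eqP.
  by ring.
Qed.

Definition rich_energy k := (\sum_(z | 8 * k <= r z) r z ^ 2)%N.

(** Induction by doubling [k], ending when [8 * k] exceeds [#|I|]. Fibres of size in [[8k, 16k)]
    contribute at most [256 * k ^ 2] each and are counted by [rich_fibers]. The first term is a
    geometric series; the second closes because [k + (2 * #|I| - 2 * k) = 2 * #|I| - k]. *)
Lemma rich_energy_bound k : (0 < k)%N ->
  (k * rich_energy k <= 128 * #|S| ^ 2 + 64 * #|S| * k * (2 * #|I| - k))%N.
Proof.
elim/ltn_ind: {k}(#|I| - k)%N {-2}k (erefl (#|I| - k)%N) => m IH k mE k0.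
have [nk|kn] := ltnP #|I| (8 * k).
  rewrite /rich_energy big_pred0 ?muln0 // => z.
  apply/negbTE; rewrite -ltnNge; apply: leq_ltn_trans nk; exact: fiber_le_index.
have step : (rich_energy k <= #|[set z | 8 * k <= r z]| * (256 * k ^ 2) + rich_energy (2 * k))%N.
  rewrite /rich_energy (bigID (fun z => 8 * (2 * k) <= r z)%N) /= addnC; apply: leq_add.
    rewrite -sum_nat_const big_mkcond [leqRHS]big_mkcond /=; apply: leq_sum => z _.
    rewrite inE; case: (leqP (8 * k) (r z)) => //= h1.
    case: (leqP (8 * (2 * k)) (r z)) => //= h2.
    have -> : (256 * k ^ 2 = (16 * k) ^ 2)%N by ring.
    by rewrite leq_exp2r //; lia.
  rewrite big_mkcond [leqRHS]big_mkcond /=; apply: leq_sum => z _.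
  by case: (8 * (2 * k) <= r z)%N; rewrite ?andbF ?andbT //; case: ifP.
have IH2 : (2 * k * rich_energy (2 * k) <=
   128 * #|S| ^ 2 + 64 * #|S| * (2 * k) * (2 * #|I| - 2 * k))%N.
  by apply: (IH (#|I| - 2 * k)%N) => //; lia.
have rb := rich_fibers k.-1; rewrite prednK // in rb.
set v := #|[set z | _]%N| in step rb.
have [d dE] : exists d, (#|I| = k + d)%N by exists (#|I| - k)%N; lia.
move: IH2; rewrite dE.
have -> : (2 * (k + d) - 2 * k = 2 * d)%N by lia.
have -> : (2 * (k + d) - k = k + 2 * d)%N by lia.
move=> IH2.
have : (k * rich_energy k <= 64 * (4 * v * k ^ 3) + k * rich_energy (2 * k))%N.
  apply: leq_trans (leq_mul (leqnn k) step) _.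
  by apply/eq_leq; ring.
move: IH2 rb; clear; set e := rich_energy (2 * k); set e' := rich_energy k.
set n := #|S|; set w := (4 * v * k ^ 3)%N => h1 h2 h3.
have {}h1 : (2 * (k * e) <= 2 * (64 * n ^ 2 + 64 * (n * k * (2 * d))))%N.
  by apply: leq_trans (leq_trans h1 _); apply/eq_leq; ring.
rewrite leq_pmul2l // in h1.
apply: leq_trans h3 _; apply: leq_trans (leq_add (leq_mul (leqnn 64) h2) h1) _.
by apply/eq_leq; ring.
Qed.

End Fibers.

(** Fibres smaller than [8 * K] contribute at most [8 * K * #|S| * #|I|]; the others fall under
    [rich_energy_bound]. The free parameter avoids square roots: the best [K] is near
    [(|S| / |I|)^(1/2)], or 1 if that is smaller. *)
Lemma parabola_energy K : (0 < K)%N ->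
  (K * collisions translate <= 136 * (K ^ 2 * #|S| * #|I| + #|S| ^ 2))%N.
Proof.
move=> K0; have [Z [psi [j [jI psiE]]]] := finite_image translate.
rewrite (collisions_inj jI psiE) collisions_fibers.
have rb := rich_energy_bound jI psiE K0.
have low : (\sum_(z | ~~ (8 * K <= #|[set u | psi u == z]|)) #|[set u | psi u == z]| ^ 2
    <= 8 * K * (#|S| * #|I|))%N.
  rewrite -card_prod -(sum_fibers psi) big_distrr /= big_mkcond /=; apply: leq_sum => z _.
  by case: (leqP (8 * K)) => //= h; rewrite expnS expn1 leq_mul2r ltnW ?orbT.
rewrite (bigID (fun z => 8 * K <= #|[set u | psi u == z]|)%N) /= mulnDr.
apply: leq_trans (leq_add rb (leq_mul (leqnn K) low)) _.
have h : (64 * #|S| * K * (2 * #|I| - K) <= 128 * (K ^ 2 * #|S| * #|I|))%N.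
  apply: (@leq_trans (64 * #|S| * K * (2 * #|I|))%N); first by rewrite leq_mul2l leq_subr orbT.
  have -> : (64 * #|S| * K * (2 * #|I|) = 128 * (#|S| * #|I|) * K)%N by ring.
  have -> : (128 * (K ^ 2 * #|S| * #|I|) = 128 * (#|S| * #|I|) * (K * K))%N by ring.
  by rewrite leq_mul2l leq_pmulr ?orbT.
have -> : (136 * (K ^ 2 * #|S| * #|I| + #|S| ^ 2) =
  8 * #|S| ^ 2 + 128 * #|S| ^ 2 + 128 * (K ^ 2 * #|S| * #|I|) + K * (8 * K * (#|S| * #|I|)))%N by ring.
by rewrite leq_add2r; apply: leq_add => //; rewrite leq_addl.
Qed.

End ParabolaEnergy.

(** * Collision counts under injections and colourings *)

Lemma collisions_leq (U V : finType) (Y : eqType) (h : U -> V) (psi : U -> Y) (psi' : V -> Y) :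
  injective h -> (forall u, psi u = psi' (h u)) -> (collisions psi <= collisions psi')%N.
Proof.
move=> hI hE; have inj : injective (fun p : U * U => (h p.1, h p.2)).
  by move=> [u v] [u' v'] [/hI -> /hI ->].
rewrite /collisions -(card_imset _ inj); apply/subset_leq_card/subsetP => q /imsetP[p].
by rewrite !inE !hE => hp ->.
Qed.

Lemma sum_nat_sqr_le (C : finType) (g : C -> nat) :
  ((\sum_c g c) ^ 2 <= #|C| * \sum_c g c ^ 2)%N.
Proof.
rewrite -(@leq_pmul2l 2) //.
have -> : (2 * (\sum_c g c) ^ 2 = \sum_c \sum_d 2 * (g c * g d))%N.
  rewrite expnS expn1 big_distrlr /= big_distrr /=; apply: eq_bigr => c _.
  by rewrite big_distrr.
have -> : (2 * (#|C| * \sum_c g c ^ 2) = \sum_c \sum_d (g c ^ 2 + g d ^ 2))%N.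
  rewrite mul2n -addnn -[in LHS]sum_nat_const -big_split /=.
  under [RHS]eq_bigr do rewrite big_split /= sum_nat_const.
  rewrite [RHS]big_split /= -big_distrr /= [LHS]big_split /=.
  by rewrite sum_nat_const.
by apply: leq_sum => c _; apply: leq_sum => d _; apply: nat_Cauchy.
Qed.

(** Cauchy-Schwarz in each fibre of [psi], split according to colour. *)
Lemma collisions_color (U C : finType) (Y : choiceType) (psi : U -> Y) (c : U -> C) :
  (collisions psi <= #|C| * collisions (fun u => (psi u, c u)))%N.
Proof.
have [Z [psi' [j [jI psiE]]]] := finite_image psi.
rewrite (collisions_inj jI psiE).
have jI' : injective (fun zc : Z * C => (j zc.1, zc.2)).
  by move=> [z d] [z' d'] [/jI -> ->].
rewrite (@collisions_inj _ (Z * C)%type _ (fun u => (psi' u, c u)) _ _ jI'); last first.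
  by move=> u; rewrite psiE.
rewrite !collisions_fibers -(pair_big predT predT (fun z d => #|[set u | (psi' u, c u) == (z, d)]| ^ 2)%N) /=.
rewrite big_distrr; apply: leq_sum => z _ /=.
apply: leq_trans (sum_nat_sqr_le _); rewrite leq_exp2r //; apply: eq_leq.
rewrite -sum1dep_card (partition_big c predT) //=; apply: eq_bigr => d _.
by rewrite sum1dep_card; apply: eq_card => u; rewrite !inE.
Qed.

(** * Dyadic decomposition of the representation function *)

Section EnergyOn.
Variables (R : realFieldType) (I : finType) (a : I -> R).
Hypothesis a_inj : injective a.

(** The restriction to [D] serves level sets, and also differences inside blocks, which are
    injective only off the diagonal. *)
Lemma parabola_energy_on (Z : finType) (j : Z -> R * R) (D : {set Z}) K :
  {in D &, injective j} -> (0 < K)%N ->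
  (K * #|[set q : (Z * I) * (Z * I) | [&& q.1.1 \in D, q.2.1 \in D &
            (j q.1.1 + parab (a q.1.2) == j q.2.1 + parab (a q.2.2))%R]]|
    <= 136 * (K ^ 2 * #|D| * #|I| + #|D| ^ 2))%N.
Proof.
move=> jI K0; pose S : finType := {z | z \in D}.
have sI : injective (fun s : S => j (val s)).
  by move=> s s' h; apply/val_inj/jI => //; apply: valP.
have := parabola_energy sI a_inj K0.
have -> : #|S| = #|D| by rewrite card_sig; apply: eq_card.
apply: leq_trans; rewrite leq_mul2l; apply/orP; right.
rewrite /collisions -(card_imset _ (f := fun q : (S * I) * (S * I) =>
   ((val q.1.1, q.1.2), (val q.2.1, q.2.2)))); last first.
  by move=> [[s i] [s' i']] [[t k] [t' k']] /= [/val_inj -> -> /val_inj -> ->].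
apply/subset_leq_card/subsetP => -[[z i] [z' i']]; rewrite inE /= => /and3P[zD zD' h].
apply/imsetP; exists ((exist _ z zD, i), (exist _ z' zD', i')) => //.
by rewrite inE.
Qed.

(** Colouring by multiplicity level reduces to collisions within one level and costs one factor
    [L.+1]; summing over the levels costs the other. *)
Lemma energy_step (T : finType) (phi : T -> R * R) K : (0 < K)%N ->
  (K * collisions (fun u : T * I => (phi u.1 + parab (a u.2))%R) <=
   544 * (trunc_log 2 #|T|).+1 ^ 2 * (K ^ 2 * collisions phi * #|I| + #|T| ^ 2))%N.
Proof.
move=> K0; set L := trunc_log 2 #|T|.
have [Z [f [j [jI fE]]]] := finite_image phi.
pose r z := #|[set t | f t == z]|.
have rT z : (r z <= #|T|)%N by apply: max_card.
pose lev z : 'I_L.+1 := inord (trunc_log 2 (r z)).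
have levE z : lev z = trunc_log 2 (r z) :> nat.
  by rewrite inordK // ltnS leq_trunc_log.
pose Psi (u : T * I) := phi u.1 + parab (a u.2).
pose Q (l : 'I_L.+1) := #|[set p : (T * I) * (T * I) |
   [&& Psi p.1 == Psi p.2, lev (f p.1.1) == l & lev (f p.2.1) == l]]|.
have split_levels : (collisions Psi <= L.+1 * \sum_l Q l)%N.
  have := collisions_color Psi (fun u => lev (f u.1)); rewrite card_ord.
  move=> h; apply: leq_trans h _; rewrite leq_mul2l /=; apply: eq_leq.
  rewrite /collisions -sum1dep_card (partition_big (fun p => lev (f p.1.1)) predT) //=.
  apply: eq_bigr => l _; rewrite sum1dep_card; apply: eq_card => p; rewrite !inE xpair_eqE.
  by case: eqP => //= _; apply/andP/andP => -[/eqP h /eqP h']; split; apply/eqP; congruence.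
(* Since [trunc_log 2 0 = 0], an empty fibre would otherwise be placed in level zero. *)
pose D (l : 'I_L.+1) := [set z | (0 < r z)%N && (lev z == l)].
have levD (l : 'I_L.+1) z : z \in D l -> (2 ^ l <= r z < 2 ^ l.+1)%N.
  by rewrite inE => /andP[r0 /eqP <-]; rewrite levE; apply: trunc_log_bounds.
have Dcoll (l : 'I_L.+1) : (4 ^ l * #|D l| <= collisions phi)%N.
  rewrite (collisions_inj jI fE) collisions_fibers mulnC -sum_nat_const big_mkcond /=.
  apply: leq_sum => z _; case: ifP => // /levD /andP[h _].
  by rewrite -[4%N]/(2 ^ 2)%N -expnM mulnC expnM leq_exp2r.
have DT (l : 'I_L.+1) : (2 ^ l * #|D l| <= #|T|)%N.
  rewrite -(sum_fibers f) mulnC -sum_nat_const big_mkcond /=.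
  by apply: leq_sum => z _; case: ifP => // /levD /andP[h _].
have level (l : 'I_L.+1) : (K * Q l <= 544 * (K ^ 2 * collisions phi * #|I| + #|T| ^ 2))%N.
  set X := [set q : (Z * I) * (Z * I) | [&& q.1.1 \in D l, q.2.1 \in D l &
            (j q.1.1 + parab (a q.1.2) == j q.2.1 + parab (a q.2.2))%R]].
  (* Multiplicities in level [l] are below [2 ^ l.+1], so each element of [X] lifts to at most
     [4 ^ l.+1] collisions. *)
  have QX : (Q l <= 4 ^ l.+1 * #|X|)%N.
    rewrite /Q -sum1dep_card.
    rewrite (partition_big (fun p : (T * I) * (T * I) => ((f p.1.1, p.1.2), (f p.2.1, p.2.2))) (mem X)) /=.
      rewrite mulnC -sum_nat_const; apply: leq_sum => -[[z i] [z' i']] /= qX.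
      have [zD zD'] : z \in D l /\ z' \in D l by move: qX; rewrite inE => /and3P[].
      apply: (@leq_trans (r z * r z')%N); last first.
        have /andP[_ h] := levD _ _ zD; have /andP[_ h'] := levD _ _ zD'.
        by rewrite -[4%N]/(2 * 2)%N expnMn; apply: leq_mul; apply: ltnW.
      rewrite sum1dep_card /r -cardsX.
      rewrite -(card_imset _ (f := fun tt : T * T => ((tt.1, i), (tt.2, i')))); last first.
        by move=> [? ?] [? ?] /= [-> ->].
      apply/subset_leq_card/subsetP => -[[t k] [t' k']].
      rewrite inE /= !xpair_eqE => /andP[_].
      move=> /andP[/andP[/eqP h /eqP ->] /andP[/eqP h' /eqP ->]].
      by apply/imsetP; exists (t, t'); rewrite ?inE /= ?h ?h' ?eqxx.
    move=> [[t k] [t' k']] /= /and3P[h h1 h2]; rewrite inE /= -!fE.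
    by rewrite h !inE h1 h2 !andbT /=; apply/andP; split; apply/card_gt0P; [exists t|exists t']; rewrite inE.
  have := parabola_energy_on (D := D l) (in2W jI) K0; rewrite -/X => hX.
  have h1 : (K * Q l <= 4 ^ l.+1 * (136 * (K ^ 2 * #|D l| * #|I| + #|D l| ^ 2)))%N.
    apply: leq_trans (leq_mul (leqnn (4 ^ l.+1)) hX).
    by apply: leq_trans (leq_mul (leqnn K) QX) _; rewrite mulnCA.
  apply: leq_trans h1 _.
  (* Distributing [4 ^ l] produces exactly the quantities bounded by [Dcoll] and [DT]; the remaining
     constant is [544 = 4 * 136]. *)
  have -> : (4 ^ l.+1 * (136 * (K ^ 2 * #|D l| * #|I| + #|D l| ^ 2)) =
     544 * (K ^ 2 * (4 ^ l * #|D l|) * #|I| + (2 ^ l * #|D l|) ^ 2))%N.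
    have e4 : (4 ^ l = (2 ^ l) ^ 2)%N by rewrite -[4%N]/(2 ^ 2)%N -!expnM mulnC.
    by rewrite expnS e4; ring.
  by rewrite leq_mul2l /= leq_add // ?leq_exp2r // leq_mul // leq_mul.
apply: leq_trans (leq_mul (leqnn K) split_levels) _.
rewrite mulnCA big_distrr /=.
have -> : (544 * L.+1 ^ 2 * (K ^ 2 * collisions phi * #|I| + #|T| ^ 2) =
  L.+1 * (L.+1 * (544 * (K ^ 2 * collisions phi * #|I| + #|T| ^ 2))))%N by ring.
rewrite leq_mul2l /=; apply: leq_trans (leq_sum (P := xpredT) _ (fun l _ => level l)) _.
by rewrite sum_nat_const card_ord.
Qed.

End EnergyOn.

(** * Three squares *)

(** The two equations combine into [(x - x') * (x - y') = 0]. *)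
Lemma parab_sum2 (R : realFieldType) (x y x' y' : R) :
  parab x + parab y = parab x' + parab y' -> x = x' /\ y = y' \/ x = y' /\ y = x'.
Proof.
case=> h1 h2; have : (x - x') * (x - y') = 0.
  have -> : y' = x + y - x' by rewrite h1; ring.
  have -> : (x - x') * (x - (x + y - x')) = ((x + y - x') ^+ 2 - (x ^+ 2 + y ^+ 2 - x' ^+ 2)) / -2 by field.
  by rewrite h2 h1; field.
by move/eqP; rewrite mulf_eq0 !subr_eq0 => /orP[] /eqP h; [left | right]; split => //; lra.
Qed.

(** Transposing gives an instance of [parab_sum2], whose swapped case forces [x = y]. *)
Lemma parab_diff_inj (R : realFieldType) (x y x' y' : R) : x != y ->
  parab x - parab y = parab x' - parab y' -> x = x' /\ y = y'.
Proof.
move=> ne h; have /parab_sum2[] : parab x + parab y' = parab x' + parab y.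
  by rewrite -(subrK (parab y) (parab x)) h addrAC subrK.
  by move=> [-> ->].
by move=> [xy _]; case/eqP: ne.
Qed.

(* On the circle [x1 + x2 + x3 = const], [x1^2 + x2^2 + x3^2 = const], the signs of
   [x1 - x3] and [x2 - x3] cut out arcs on which [x2] is monotone in [x1]. *)
Lemma circle_arc_monotone (R : realFieldType) (x1 x2 x3 y1 y2 y3 : R) :
  parab x1 + parab x2 + parab x3 = parab y1 + parab y2 + parab y3 ->
  (x1 <= x3) = (y1 <= y3) -> (x2 <= x3) = (y2 <= y3) -> x1 < y1 ->
  if (x1 <= x3) == (x2 <= x3) then y2 <= x2 else x2 <= y2.
Proof.
case=> h1 h2 c1 c2 lt1.
(* Here [p = (x1 - x3) + (y1 - y3)], and similarly for [q], so their signs are fixed by the arc. The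
   chord relation [pq] then ties the sign of [x2 - y2] to that of [x1 - y1]. *)
pose p := x1 + y1 - x3 - y3; pose q := x2 + y2 - x3 - y3.
have pq : (x1 - y1) * p + (x2 - y2) * q = 0.
  have -> : (x1 - y1) * p + (x2 - y2) * q =
     (x1 ^+ 2 + x2 ^+ 2 + x3 ^+ 2 - (y1 ^+ 2 + y2 ^+ 2 + y3 ^+ 2))
     - (x3 + y3) * (x1 + x2 + x3 - (y1 + y2 + y3)) by rewrite /p /q; ring.
  by rewrite h1 h2; ring.
case: (lerP x1 x3) c1 => [a|a] /esym c1; case: (lerP x2 x3) c2 => [b|b] /esym c2 /=.
- have p0 : p <= 0 by rewrite /p; lra.
  have : q <= 0 by rewrite /q; lra.
  rewrite le_eqVlt => /orP[/eqP q0|q0]; last by nra.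
  (* When [p] and [q] both vanish, [x1 = x2 = x3] and [y1 = y2 = y3], which the equal sums
     exclude. *)
  have /eqP : (x1 - y1) * p = 0 by rewrite -pq q0; ring.
  by rewrite mulf_eq0 subr_eq0 (lt_eqF lt1) /= => /eqP; move: q0; rewrite /p /q => *; lra.
- move/negbT: c2; rewrite -ltNge => c2.
  have p0 : p <= 0 by rewrite /p; lra.
  have q0 : 0 < q by rewrite /q; lra.
  by nra.
- move/negbT: c1; rewrite -ltNge => c1.
  have p0 : 0 < p by rewrite /p; lra.
  have : q <= 0 by rewrite /q; lra.
  rewrite le_eqVlt => /orP[/eqP q0|q0]; last by nra.
  have /eqP : (x1 - y1) * p = 0 by rewrite -pq q0; ring.
  by rewrite mulf_eq0 subr_eq0 (lt_eqF lt1) (gt_eqF p0).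
- move/negbT: c1; rewrite -ltNge => c1; move/negbT: c2; rewrite -ltNge => c2.
  have p0 : 0 < p by rewrite /p; lra.
  have q0 : 0 < q by rewrite /q; lra.
  by nra.
Qed.

(** * Cutting into blocks and the bound for three variables *)

Section CubicEnergy.
Variables (R : realFieldType) (I : finType) (a : I -> R) (M : nat).
Hypotheses (a_inj : injective a) (M0 : (0 < M)%N) (IM : (#|I| <= M ^ 3)%N).

Definition rank i := #|[set k | a k < a i]|.
Definition block i := (rank i %/ M ^ 2)%N.

Lemma rank_lt i i' : a i < a i' -> (rank i < rank i')%N.
Proof.
move=> h; apply: proper_card; apply/properP; split.
  by apply/subsetP => k; rewrite !inE => /lt_trans; apply.
by exists i; rewrite !inE ?ltxx.
Qed.

Lemma rank_inj : injective rank.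
Proof.
move=> i i' h; apply: a_inj; have [/rank_lt|/rank_lt|//] := ltgtP (a i) (a i').
  by rewrite h ltnn.
by rewrite h ltnn.
Qed.

Lemma block_mono i i' : a i <= a i' -> (block i <= block i')%N.
Proof.
rewrite le_eqVlt => /orP[/eqP/a_inj -> //|/rank_lt/ltnW h].
exact: leq_div2r.
Qed.

Lemma block_lt i : (block i < M)%N.
Proof.
rewrite ltn_divLR ?expn_gt0 ?M0 // -expnS; apply: leq_trans IM.
rewrite -cardsT; apply: proper_card; apply/properP; split; first exact: subsetT.
by exists i; rewrite !inE ?ltxx.
Qed.

Definition local_pairs := [set p : I * I | (p.1 != p.2) && (block p.1 == block p.2)].

(** The first entry fixes the block, and inside a block the second entry is fixed by its rank modulo
    [M ^ 2]. *)
Lemma card_local_pairs : (#|local_pairs| <= #|I| * M ^ 2)%N.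
Proof.
have M2 : (0 < M ^ 2)%N by rewrite expn_gt0 M0.
pose f (p : I * I) := (p.1, Ordinal (ltn_pmod (rank p.2) M2)).
have inj : {in local_pairs &, injective f}.
  move=> [i k] [i' k']; rewrite !inE /= => /andP[_ /eqP b] /andP[_ /eqP b'] [ii kk].
  rewrite -ii in b' *; congr pair; apply: rank_inj.
  by rewrite (divn_eq (rank k) (M ^ 2)) (divn_eq (rank k') (M ^ 2)) kk -/(block k) -b b'.
rewrite -[X in (_ * X)%N]card_ord -card_prod -(card_in_imset inj).
exact: max_card.
Qed.

Local Notation T := (I * I * I)%type.
Definition psum (x : T) := parab (a x.1.1) + parab (a x.1.2) + parab (a x.2).

(** The booleans select an arc. The number adds two quantities that are both nondecreasing along it:
    [block x.1.1], and the second block or its reflection according to the direction of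
    monotonicity. Equal sums therefore mean equal cells. All values stay within the range of
    [inord]. *)
Definition circle_color (x : T) : bool * bool * 'I_(2 * M).+1 :=
  let c1 := a x.1.1 <= a x.2 in let c2 := a x.1.2 <= a x.2 in
  (c1, c2, inord (if c1 == c2 then block x.1.1 + (M - block x.1.2)
                  else block x.1.1 + block x.1.2)%N).

Lemma circle_color_arc (x y : T) : psum x = psum y ->
  circle_color x = circle_color y -> a x.1.1 < a y.1.1 ->
  block x.1.1 = block y.1.1 /\ block x.1.2 = block y.1.2.
Proof.
move=> h [c1 c2 k] lt1.
have b1 := block_mono (ltW lt1).
have x1 := block_lt x.1.1; have x2 := block_lt x.1.2.
have y1 := block_lt y.1.1; have y2 := block_lt y.1.2.
have := circle_arc_monotone h c1 c2 lt1; move/(congr1 val): k; rewrite /= -c1 -c2.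
case: eqP => _; rewrite !inordK; try by lia.
  by move=> k /block_mono; lia.
by move=> k /block_mono; lia.
Qed.

Lemma circle_color_local (x y : T) : psum x = psum y ->
  circle_color x = circle_color y ->
  block x.1.1 = block y.1.1 /\ block x.1.2 = block y.1.2.
Proof.
move=> h k; have [lt1|lt1|eq1] := ltgtP (a x.1.1) (a y.1.1).
- exact: circle_color_arc.
- by have [-> ->] := circle_color_arc (esym h) (esym k) lt1.
(* Equal first coordinates leave a two-variable equation; in its swapped case the number in the
   colour still determines the second block. *)
- split; first by rewrite (a_inj eq1).
  move: h k; rewrite /psum eq1 -!addrA => /addrI /parab_sum2[[/a_inj -> //]|[e2 e3]].
  rewrite /circle_color e2 e3 eq1 (a_inj eq1) => -[c1 c2 k].
  have x2 := block_lt x.1.2; have y1 := block_lt y.1.1; have y2 := block_lt y.1.2.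
  move/(congr1 val): k; rewrite /= -c1 -c2.
  by case: eqP => _; rewrite !inordK; try lia; move=> k; lia.
Qed.

Definition local_coll := [set p : T * T | [&& psum p.1 == psum p.2,
  block p.1.1.1 == block p.2.1.1 & block p.1.1.2 == block p.2.1.2]].

Lemma collisions_local : (collisions psum <= 4 * (2 * M).+1 * #|local_coll|)%N.
Proof.
apply: leq_trans (collisions_color psum circle_color) _.
rewrite !card_prod card_bool card_ord leq_mul2l; apply/orP; right.
apply/subset_leq_card/subsetP => -[x y]; rewrite !inE xpair_eqE /= => /andP[/eqP h /eqP k].
by have [-> ->] := circle_color_local h k; rewrite h !eqxx.
Qed.

(** With equal first coordinates, [y] is [x] up to exchanging the last two entries, and one boolean
    records which case holds. *)
Lemma card_diag1 : (#|[set p : T * T | (psum p.1 == psum p.2) && (p.1.1.1 == p.2.1.1)]|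
  <= 2 * #|I| ^ 3)%N.
Proof.
pose f (p : T * T) := (p.1, p.1.1.2 == p.2.1.2).
have inj : {in [set p : T * T | (psum p.1 == psum p.2) && (p.1.1.1 == p.2.1.1)] &, injective f}.
  move=> [[[x1 x2] x3] [[y1 y2] y3]] [[[x1' x2'] x3'] [[z1 z2] z3]].
  rewrite !inE /= => /andP[/eqP h /eqP e1] /andP[/eqP h' /eqP e1'] [].
  move=> E1 E2 E3 k; move: h h' k; rewrite -E1 -E2 -E3 -e1 -e1' -E1 {x1' x2' x3' E1 E2 E3 e1 e1'}.
  rewrite /psum /= -!addrA => /addrI/parab_sum2 h /addrI/parab_sum2 h'.
  by move: h h' => [[/a_inj <- /a_inj <-]|[/a_inj <- /a_inj <-]] [[/a_inj <- /a_inj <-]|[/a_inj <- /a_inj <-]];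
    rewrite ?eqxx //; first [by move/eqP=> -> | by move/esym/eqP=> ->].
have -> : (2 * #|I| ^ 3 = #|{: T * bool}|)%N by rewrite !card_prod card_bool; ring.
by rewrite -(card_in_imset inj); apply: max_card.
Qed.

Lemma card_diag2 : (#|[set p : T * T | (psum p.1 == psum p.2) && (p.1.1.2 == p.2.1.2)]|
  <= 2 * #|I| ^ 3)%N.
Proof.
pose sw (x : T) : T := (x.1.2, x.1.1, x.2).
have inj : injective (fun p : T * T => (sw p.1, sw p.2)).
  by move=> [[[x1 x2] x3] [[y1 y2] y3]] [[[x1' x2'] x3'] [[z1 z2] z3]] [-> -> -> -> -> ->].
apply: leq_trans card_diag1; rewrite -(card_imset _ inj).
apply/subset_leq_card/subsetP => q /imsetP[[x y]]; rewrite !inE => /andP[/eqP h e] ->.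
rewrite /= e andbT; move: h; rewrite /psum /= => h.
by rewrite [parab (a x.1.2) + _]addrC h [parab (a y.1.2) + _]addrC.
Qed.

(** Rewrite the equation as [(P x1 - P y1) + P x3 = (P y2 - P x2) + P y3], with both differences
    indexed by [local_pairs]. As there are at most [#|I| * M ^ 2] such pairs, [K = M] balances the
    two terms of the energy bound. *)
Lemma card_offdiag : (M * #|[set p in local_coll | (p.1.1.1 != p.2.1.1) && (p.1.1.2 != p.2.1.2)]|
  <= 272 * M ^ 4 * #|I| ^ 2)%N.
Proof.
pose j (z : I * I) := parab (a z.1) - parab (a z.2).
have jI : {in local_pairs &, injective j}.
  move=> [i k] [i' k']; rewrite !inE /= -(inj_eq a_inj) => /andP[ne _] _ h.
  by have [/a_inj -> /a_inj ->] := parab_diff_inj ne h.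
have := parabola_energy_on a_inj jI M0.
set X := [set q | _] => hX.
pose f (p : T * T) := (((p.1.1.1, p.2.1.1), p.1.2), ((p.2.1.2, p.1.1.2), p.2.2)).
have fI : injective f.
  by move=> [[[x1 x2] x3] [[y1 y2] y3]] [[[x1' x2'] x3'] [[z1 z2] z3]] [-> -> -> -> -> ->].
apply: leq_trans (leq_trans (leq_mul (leqnn M) _) hX) _.
  rewrite -(card_imset _ fI); apply/subset_leq_card/subsetP => q /imsetP[[x y]].
  rewrite !inE => /andP[/and3P[/eqP h /eqP b1 /eqP b2] /andP[n1 n2]] -> /=.
  rewrite n1 b1 eqxx eq_sym n2 b2 eqxx /= /j /=; move: h; rewrite /psum /= => h.
  rewrite addrAC [X in _ == X]addrAC subr_eq [X in _ == X]addrAC eq_sym subr_eq.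
  by rewrite [X in _ == X]addrAC h [X in X == _]addrC addrA.
have h := card_local_pairs.
have h2 : (#|local_pairs| ^ 2 <= (#|I| * M ^ 2) ^ 2)%N by rewrite leq_exp2r.
apply: (@leq_trans (136 * (M ^ 2 * (#|I| * M ^ 2) * #|I| + (#|I| * M ^ 2) ^ 2))%N).
  by rewrite leq_mul2l /= leq_add // leq_mul // leq_mul.
by apply/eq_leq; ring.
Qed.

(** Local solutions with [x1 = y1] or [x2 = y2] are counted directly, the others by
    [card_offdiag]. *)
Lemma cubic_energy : (collisions psum <= 12 * M * (4 * #|I| ^ 3 + 272 * M ^ 3 * #|I| ^ 2))%N.
Proof.
apply: leq_trans collisions_local _; apply: leq_mul; first by lia.
pose B1 := [set p : T * T | (psum p.1 == psum p.2) && (p.1.1.1 == p.2.1.1)].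
pose B2 := [set p : T * T | (psum p.1 == psum p.2) && (p.1.1.2 == p.2.1.2)].
pose B3 := [set p in local_coll | (p.1.1.1 != p.2.1.1) && (p.1.1.2 != p.2.1.2)].
have h1 : (#|B1| <= _)%N := card_diag1; have h2 : (#|B2| <= _)%N := card_diag2.
have h3 : (M * #|B3| <= _)%N := card_offdiag.
have {}h3 : (#|B3| <= 272 * M ^ 3 * #|I| ^ 2)%N.
  by rewrite -(leq_pmul2l M0); apply: leq_trans h3 _; apply/eq_leq; ring.
have sub : local_coll \subset B1 :|: B2 :|: B3.
  apply/subsetP => p; rewrite !inE => /and3P[-> -> ->] /=.
  by case: (p.1.1.1 == _) => //; case: (p.1.1.2 == _).
apply: leq_trans (subset_leq_card sub) _; apply: leq_trans (leq_card_setU _ _) _.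
apply: leq_add => //; apply: leq_trans (leq_card_setU _ _) _; lia.
Qed.

End CubicEnergy.

(** * Induction on the number of variables *)

Definition parab_sum (R : realType) (A : {fset R}) (s : nat) (x : {ffun 'I_s -> A}) : R * R :=
  \sum_(i < s) parab (val (x i)).

Lemma J2E (R : realType) (s : nat) (A : {fset R}) : J2 s A = collisions (@parab_sum R A s).
Proof.
apply: eq_card => p; rewrite !inE -[in RHS]subr_eq0 /parab_sum -sumrB.
have -> : \sum_(i < s) (parab (val (p.1 i)) - parab (val (p.2 i))) =
   (\sum_(i < s) (val (p.1 i) - val (p.2 i)), \sum_(i < s) (val (p.1 i) ^+ 2 - val (p.2 i) ^+ 2)).
  by elim/big_rec3: _ => // i y1 y2 y3 _ ->.
by rewrite andbC -xpair_eqE.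
Qed.

Lemma J2_fset0 (R : realType) (s : nat) (A : {fset R}) : (0 < s)%N -> #|` A|%fset = 0%N -> J2 s A = 0%N.
Proof.
rewrite cardfE => s0 A0; apply/eqP; rewrite cards_eq0 -subset0; apply/subsetP => -[x y] _.
by have := fintype0 (x (Ordinal s0)) A0.
Qed.

Lemma J2_succ (R : realType) (s : nat) (A : {fset R}) (K : nat) : (0 < K)%N ->
  (K * J2 s.+1 A <= 544 * (trunc_log 2 (#|` A|%fset ^ s)).+1 ^ 2 *
     (K ^ 2 * J2 s A * #|` A|%fset + (#|` A|%fset ^ s) ^ 2))%N.
Proof.
move=> K0; have := energy_step (@val_inj _ _ A) (@parab_sum R A s) K0.
rewrite -J2E card_ffun card_ord cardfE; apply: leq_trans; rewrite leq_mul2l; apply/orP; right.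
rewrite J2E; pose h (x : {ffun 'I_s.+1 -> A}) := ([ffun i => x (lift ord0 i)] : {ffun 'I_s -> A}, x ord0).
apply: (@collisions_leq _ _ _ h).
  move=> x y [/ffunP e1 e2]; apply/ffunP => i; case: (unliftP ord0 i) => [k ->|-> //].
  by have := e1 k; rewrite !ffunE.
move=> x; rewrite /parab_sum big_ord_recl addrC /=; congr (_ + _).
by apply: eq_bigr => i _; rewrite ffunE.
Qed.

Lemma J2_cubic (R : realType) (A : {fset R}) (M : nat) : (0 < M)%N -> (#|` A|%fset <= M ^ 3)%N ->
  (J2 3 A <= 12 * M * (4 * #|` A|%fset ^ 3 + 272 * M ^ 3 * #|` A|%fset ^ 2))%N.
Proof.
rewrite cardfE => M0 AM; apply: leq_trans (cubic_energy (@val_inj _ _ A) M0 AM); rewrite J2E.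
pose h (x : {ffun 'I_3 -> A}) := (x (inord 0), x (inord 1), x (inord 2)).
apply: (@collisions_leq _ _ _ h).
  move=> x y [e0 e1 e2]; apply/ffunP => i; rewrite -(inord_val i).
  by case: i => -[|[|[|]]].
move=> x; rewrite /parab_sum !big_ord_recl big_ord0 addr0 /psum addrA /h /=.
by congr (parab (val (x _)) + parab (val (x _)) + parab (val (x _))); apply: val_inj; rewrite /= inordK.
Qed.

(** * Passage to real exponents *)

Lemma nat_between_double (R : realType) (x : R) : 1 <= x ->
  exists M : nat, [/\ (0 < M)%N, x <= M%:R & M%:R <= 2 * x].
Proof.
move=> x1; exists (Num.trunc x).+1; split => //; first exact: ltW (truncnS_gt x).
have : (Num.trunc x)%:R <= x by rewrite truncn_le; lra.
by rewrite -natr1; lra.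
Qed.

(** Bernoulli's inequality for [(2]^ e) ^+ l[, which is at most]N [^ d] because [2 ^ l <= N ^ s.+1]
    and [e = d / s.+1]. Using [s.+1] keeps the division meaningful for [s = 0]. *)
Lemma trunc_log_powR (R : realType) (s : nat) (d : R) : 0 < d ->
  exists2 C : R, 0 < C &
    forall N : nat, (0 < N)%N -> (trunc_log 2 (N ^ s)).+1%:R <= C * N%:R `^ d.
Proof.
move=> d0; pose e := d / s.+1%:R; pose b := (2 : R) `^ e - 1.
have e0 : 0 < e by rewrite divr_gt0.
have b0 : 0 < b.
  have pe : (1 : R) `^ e = 1 by rewrite powR1.
  by rewrite subr_gt0 -[ltLHS]pe; apply: gt0_ltr_powR; rewrite ?nnegrE //; lra.
exists (1 + b^-1); first by rewrite addr_gt0 ?invr_gt0.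
move=> N N0; set l := trunc_log 2 (N ^ s).
have N1 : (1 : R) <= N%:R by rewrite ler1n.
have lN : (2 ^ l)%:R <= (N%:R : R) ^+ s.+1.
  rewrite -natrX ler_nat; apply: leq_trans (trunc_logP (ltnSn 1) _) _; first by rewrite expn_gt0 N0.
  by rewrite leq_pexp2l.
have h1 : (1 + b) ^+ l <= N%:R `^ d.
  have -> : 1 + b = 2 `^ e by rewrite /b; lra.
  have -> : (2 `^ e) ^+ l = (2 ^+ l) `^ e.
    by rewrite -!powR_mulrn ?powR_ge0 // -!powRrM mulrC.
  have -> : N%:R `^ d = (N%:R ^+ s.+1) `^ e.
    rewrite -powR_mulrn // -powRrM; congr (_ `^ _).
    by rewrite /e mulrC divfK // pnatr_eq0.
  apply: ge0_ler_powR; rewrite ?nnegrE ?exprn_ge0 //; first exact: ltW.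
  by have := lN; rewrite natrX.
have h2 : 1 + l%:R * b <= (1 + b) ^+ l.
  elim: (l) => [|k IH]; first by rewrite mul0r addr0 expr0.
  rewrite exprS -natr1; apply: (@le_trans _ _ ((1 + b) * (1 + k%:R * b))).
    have : 0 <= (k%:R : R) by [].
    by nra.
  by rewrite ler_pM2l //; lra.
have h3 : 1 <= N%:R `^ d by rewrite -[leLHS](powRr0 N%:R); apply: ler_powR => //; lra.
have h4 : l%:R <= b^-1 * N%:R `^ d by rewrite ler_pdivlMl //; lra.
by rewrite -natr1 mulrDl mul1r; lra.
Qed.

(** For nonempty sets the base of the power is at least 1, so the bound weakens as [e] grows. *)
Definition J2_bound (R : realType) (s : nat) (e : R) := exists2 C : R, 0 < C &
  forall A : {fset R}, (0 < #|` A|%fset)%N -> (J2 s A)%:R <= C * (#|` A|%fset%:R) `^ e.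

Lemma J2_bound3 (R : realType) : J2_bound 3 (3 + 1 / 3 : R).
Proof.
(* From [M <= 2 * N^(1/3)]: the factor [12 * M] gives 24 and [M ^ 3] gives 8. *)
exists (24 * (4 + 272 * 8)); first by lra.
move=> A A0; set N : R := #|` A|%fset%:R.
have N1 : 1 <= N by rewrite ler1n.
pose x := N `^ (1 / 3).
have x3 : x ^+ 3 = N.
  have e3 : 1 / 3 * 3%:R = 1 :> R by field.
  by rewrite -powR_mulrn ?powR_ge0 // -powRrM e3 powRr1.
have x1 : 1 <= x by rewrite -[leLHS](powRr0 N); apply: ler_powR => //; lra.
have [M [M0 xM Mx]] := nat_between_double x1.
have AM : (#|` A|%fset <= M ^ 3)%N.
  by rewrite -(ler_nat R) natrX -/N -x3; apply: lerXn2r; rewrite ?nnegrE //; lra.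
have := J2_cubic M0 AM; rewrite -(ler_nat R) => h; apply: le_trans h _.
rewrite !natrM natrD !(natrX, natrM) -/N.
have -> : N `^ (3 + 1 / 3) = N ^+ 3 * x.
  by rewrite powRD; [rewrite powR_mulrn //; lra | apply/implyP => _; lra].
have M3 : (M%:R : R) ^+ 3 <= 8 * N.
  have -> : 8 * N = (2 * x) ^+ 3 by rewrite -x3; ring.
  by apply: lerXn2r; rewrite ?nnegrE //; lra.
have N2 : 0 <= N ^+ 2 by rewrite exprn_ge0 //; lra.
apply: (@le_trans _ _ (12 * (2 * x) * (4 * N ^+ 3 + 272 * (8 * N) * N ^+ 2))).
  apply: ler_pM.
  - by rewrite mulr_ge0.
  - by rewrite addr_ge0 // !mulr_ge0 ?exprn_ge0 //; lra.
  - by lra.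
  - by rewrite lerD2l; apply: ler_wpM2r => //; lra.
by rewrite le_eqVlt; apply/orP; left; apply/eqP; ring.
Qed.

Lemma J2_bound_succ (R : realType) (s : nat) (eta d : R) : eta <= 2 -> 0 < d ->
  J2_bound s (2 * s%:R - 3 + eta) -> J2_bound s.+1 (2 * s.+1%:R - 3 + (eta / 2 + d)).
Proof.
move=> eta2 d0 [C C0 JC].
have d20 : 0 < d / 2 by lra.
have [D D0 LD] := trunc_log_powR s d20.
exists (544 * D ^+ 2 * (2 * C + 1)); first by rewrite !mulr_gt0 ?exprn_gt0 //; lra.
move=> A A0; have {}JC := JC A A0; have {}LD := LD _ A0.
have := @J2_succ R s A; move: JC LD; set n := #|` A|%fset; set N : R := n%:R.
set J := (J2 s A)%:R; set J' := (J2 s.+1 A)%:R; set L := (trunc_log 2 _).+1 => JC LD step.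
have N1 : 1 <= N by rewrite ler1n.
have N0 : N != 0 by lra.
have pD u v : N `^ (u + v) = N `^ u * N `^ v by rewrite powRD // N0 implybT.
(* This size of [K] balances [K ^ 2 * J * N] against [N ^ (2 * s)]; the hypothesis [eta <= 2] makes
   it at least 1. *)
pose x := N `^ (1 - eta / 2).
have x1 : 1 <= x by rewrite -[leLHS](powRr0 N); apply: ler_powR => //; lra.
have [K [K0 xK Kx]] := nat_between_double x1.
have {step} := step _ K0; rewrite -(ler_nat R) !(natrX, natrD, natrM) -/J -/J' -/N => step.
have Ns : N ^+ s = N `^ s%:R by rewrite powR_mulrn //; lra.
have KR0 : 0 < (K%:R : R) by rewrite ltr0n.
have J0 : 0 <= J by [].
have L2 : (L%:R : R) ^+ 2 <= D ^+ 2 * N `^ d.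
  have -> : N `^ d = (N `^ (d / 2)) ^+ 2 by rewrite expr2 -pD; congr (_ `^ _); field.
  rewrite -exprMn; apply: lerXn2r => //; rewrite nnegrE // mulr_ge0 ?powR_ge0 //; lra.
set Y := N `^ (2 * s%:R - 1 + eta / 2).
have main : J' <= 544 * L%:R ^+ 2 * ((2 * C + 1) * Y).
  rewrite -(ler_pM2l KR0); apply: le_trans step _.
  rewrite [leRHS]mulrCA; apply: ler_wpM2l; first by rewrite mulr_ge0 ?exprn_ge0.
  have h1 : K%:R ^+ 2 * J * N <= K%:R * (2 * C * Y).
    have -> : K%:R ^+ 2 * J * N = K%:R * (K%:R * J * N) by ring.
    apply: ler_wpM2l; first by lra.
    have -> : 2 * C * Y = (2 * x) * (C * N `^ (2 * s%:R - 3 + eta)) * N.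
      have -> : Y = x * N `^ (2 * s%:R - 3 + eta) * N `^ 1.
        by rewrite /x -!pD; congr (_ `^ _); field.
      by rewrite powRr1; [ring | lra].
    apply: ler_wpM2r; first by lra.
    by apply: ler_pM => //; lra.
  have h2 : (N ^+ s) ^+ 2 <= K%:R * Y.
    have -> : (N ^+ s) ^+ 2 = x * Y by rewrite Ns expr2 /x -!pD; congr (_ `^ _); field.
    by apply: ler_wpM2r => //; apply: powR_ge0.
  by lra.
have -> : N `^ (2 * s.+1%:R - 3 + (eta / 2 + d)) = Y * N `^ d.
  by rewrite -pD; congr (_ `^ _); rewrite -natr1; field.
apply: le_trans main _.
have -> : 544 * D ^+ 2 * (2 * C + 1) * (Y * N `^ d) = 544 * (D ^+ 2 * N `^ d) * ((2 * C + 1) * Y) by ring.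
apply: ler_wpM2r; first by rewrite mulr_ge0 ?powR_ge0 //; lra.
by lra.
Qed.

Lemma J2_bound_all (R : realType) (k : nat) (d : R) : 0 < d <= 1 ->
  J2_bound (k + 3) (2 * (k + 3)%:R - 3 + (1 / 3 / 2 ^+ k + d)).
Proof.
elim: k d => [|k IH] d /andP[d0 d1].
  have [C C0 CP] := J2_bound3 R; exists C => // A A0; apply: le_trans (CP A A0) _.
  apply: ler_wpM2l; first by lra.
  by apply: ler_powR; rewrite ?ler1n // add0n expr0; lra.
have dh : 0 < d / 2 <= 1 by apply/andP; split; lra.
have p0 : 0 < (2 : R) ^+ k by rewrite exprn_gt0.
have h : (1 : R) / 3 / 2 ^+ k + d / 2 <= 2.
  have : (1 : R) / 3 / 2 ^+ k <= 1 / 3.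
    by rewrite ler_pdivrMr // ler_peMr //; [lra | apply: exprn_ege1; lra].
  by lra.
(* The inductive loss [d / 2] is halved by the step, which leaves this much for the logarithms. *)
have d20 : 0 < d - (d / 2) / 2 by lra.
have := J2_bound_succ h d20 (IH _ dh); rewrite addSn.
congr (J2_bound _ (_ + _)).
by rewrite exprS; field; lra.
Qed.

Theorem corollary1p2 (R : realType) (s : nat) (hs : (3 <= s)%N) :
  exists K : R, 0 < K /\
    forall A : {fset R},
      (J2 s A)%:R <= K * (#|` A|%fset%:R) `^ (2 * s%:R - 3 + eta_exp R s).
Proof.
suff [C C0 CP] : J2_bound s (2 * s%:R - 3 + eta_exp R s).
  exists C; split=> // A; have [A0|] := posnP #|` A|%fset; last exact: CP.
  by rewrite J2_fset0 ?(leq_trans _ hs) // mulr_ge0 ?powR_ge0 // ltW.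
have [k sE] : exists k, s = (k + 3)%N by exists (s - 3)%N; rewrite subnK.
have weaken e e' : e <= e' -> J2_bound s e -> J2_bound s (e' : R).
  move=> ee [C C0 CP]; exists C => // A A0; apply: le_trans (CP A A0) _.
  by apply: ler_wpM2l; [lra | apply: ler_powR; rewrite ?ler1n].
have p0 : 0 < (2 : R) ^+ k by rewrite exprn_gt0.
(* The coefficient of [2^(-k)] becomes [1/3 + 1/8 = 11/24], below both [1/2] at [s = 3] and
   [2 * (1/4 - 1/7246)] for larger [s]. *)
pose d : R := 1 / 8 / 2 ^+ k.
have d01 : 0 < d <= 1.
  rewrite divr_gt0 //=; last by lra.
  rewrite ler_pdivrMr //; have : 1 <= (2 : R) ^+ k by apply: exprn_ege1; lra.
  by lra.
rewrite sE in weaken *; apply: weaken (J2_bound_all k d01).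
rewrite lerD2l /eta_exp /d; case: eqP => [k0|_].
  have -> : k = 0%N by lia.
  by rewrite expr0; lra.
have -> : (- (k + 3)%:Z + 4 : int) = 1 - k%:Z by lia.
rewrite expfzDr ?pnatr_eq0 // expr1z -exprnN.
rewrite -mulrDl mulrA ler_wpM2r ?invr_ge0 ?ltW //.
by clear sE; lra.
Qed.
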